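(* Consider the system $x_{k+1}=f(x_k,u_k)$ controlled by iSCD-MPC. Assume: (A1) $A:\mathbb R^n\times\mathbb R^m\to\mathbb R^{n\times n}$ and $B:\mathbb R^n\times\mathbb R^m\to\mathbb R^{n\times m}$ are continuously differentiable and there exist $L_A,L_B\in(0,\infty)$ such that for all $x,\hat x\in\mathbb R^n$, $u,\hat u\in\mathbb R^m$, $\|A(x,u)-A(\hat x,\hat u)\|\le L_A(\|x-\hat x\|+\|u-\hat u\|)$ and $\|B(x,u)-B(\hat x,\hat u)\|\le L_B(\|x-\hat x\|+\|u-\hat u\|)$; (A2) there exist $\bar a,\bar b\in(0,\infty)$ such that $\sup_{x,u}\|A(x,u)\|\le\bar a$ and $\sup_{x,u}\|B(x,u)\|\le\bar b$. Let $\delta_U\in(0,\infty)$ and $\mathcal B=\{U\in\mathbb R^{m(\ell-1)}:\|U\|\le\delta_U\}$. Let $k\in\mathbb N$, and assume that there exist $\gamma\in(0,1)$, $c_0\in[1,\infty)$, and $c_{\mathcal M}\in(0,\infty)$ such that $\|x_{k,1}\|\le\min\{\delta_U/c_0,\ \gamma/c_{\mathcal M}\}$. Let $U_{k,\star}=(u_{1,\star},\ldots,u_{\ell-1,\star})$ be the unique fixed point of $\mathcal M(x_{k,1},\cdot)$ in $\mathcal B$. Let $x_{1,\star}=x_{k,1}$ and $x_{j+1,\star}=f(x_{j,\star},u_{j,\star})$ for $j\in\{1,\ldots,\ell-1\}$ denote the rollout under $U_{k,\star}$, let $A_{j,\star}=A(x_{j,\star},u_{j,\star})$ and $B_{j,\star}=B(x_{j,\star},u_{j,\star})$,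 and define the costates $\lambda_{\ell,\star}=Px_{\ell,\star}$ and, for all $j\in\{\ell-1,\ldots,2\}$, $\lambda_{j,\star}=Qx_{j,\star}+A_{j,\star}^T\lambda_{j+1,\star}$. Then $$\big\|\nabla_{(X,U)}\mathcal L(X_{k,\star},U_{k,\star},\Lambda_{k,\star})\big\|\le\beta\sum_{j=1}^{\ell-1}\big(\|x_{j,\star}\|+\|u_{j,\star}\|\big)\|\lambda_{j+1,\star}\|,$$ where $X_{k,\star}=(x_{2,\star},\ldots,x_{\ell,\star})$ and $\Lambda_{k,\star}=(\lambda_{2,\star},\ldots,\lambda_{\ell,\star})$ stack the free predicted states and costates, respectively, and $\beta=\sqrt2\max\{L_A,L_B\}$.
   Context: $\mathbb N=\{0,1,2,\ldots\}$; $\|\cdot\|$ is the Euclidean norm on vectors and the induced norm on matrices. System: $x_{k+1}=f(x_k,u_k)$ with $x_k\in\mathbb R^n$, $u_k\in\mathbb R^m$, where $f(x,u)=A(x,u)x+B(x,u)u$ for all $(x,u)$. For each $k\in\mathbb N$, the anchor is $x_{k,1}=f(x_k,u_k)$. The horizon is an integer $\ell\ge2$. Weights: $Q\in\mathbb R^{n\times n}$ symmetric positive semidefinite, $R\in\mathbb R^{m\times m}$ symmetric positive definite, and $P\in\mathbb R^{n\times n}$ symmetric positive definite, the stabilizing solution of the discrete algebraic Riccati equation $P=A_0^TPA_0-A_0^TPB_0(2R+B_0^TPB_0)^{-1}B_0^TPA_0+2Q$, where $A_0=A(0,0)$, $B_0=B(0,0)$. Let $\mathcal Q=\mathrm{diag}(Q,\ldots,Q,P)\in\mathbb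 R^{n\ell\times n\ell}$ ($\ell-1$ copies of $Q$) and $\mathcal R=\mathrm{diag}(R,\ldots,R)\in\mathbb R^{m(\ell-1)\times m(\ell-1)}$. Iteration map: for $\xi\in\mathbb R^n$ and $U=(u_1,\ldots,u_{\ell-1})\in\mathbb R^{m(\ell-1)}$ (stacked), define the rollout $x_1(\xi,U)=\xi$, $x_{j+1}(\xi,U)=f(x_j(\xi,U),u_j)$ for $j\in\{1,\ldots,\ell-1\}$, and put $A_j=A(x_j(\xi,U),u_j)$, $B_j=B(x_j(\xi,U),u_j)$. Let $\Phi(\xi,U)\in\mathbb R^{n\ell\times n}$ be the block column with first block $I_n$ and $r$th block $A_{r-1}\cdots A_1$ for $r\in\{2,\ldots,\ell\}$. Let $\Gamma(\xi,U)\in\mathbb R^{n\ell\times m(\ell-1)}$ have $(r,c)$ block, for $r\in\{2,\ldots,\ell\}$ and $c\in\{1,\ldots,r-1\}$, equal to $B_{r-1}$ if $c=r-1$ and $A_{r-1}\cdots A_{c+1}B_c$ if $c<r-1$, all other blocks being zero. Let $\mathcal H(\xi,U)=\mathcal R+\Gamma(\xi,U)^T\mathcal Q\,\Gamma(\xi,U)$, and $$\mathcal M(\xi,U)=-\mathcal H(\xi,U)^{-1}\Gamma(\xi,U)^T\mathcal Q\,\Phi(\xi,U)\,\xi .$$ iSCD-MPC: at each step $k$, starting from a control sequence $U_{k|1}$, the iterates $U_{k|i}$, $i\ge2$, solve the linear-quadratic program whose coefficients are frozen along the rollout from $x_{k,1}$ under $U_{k|i-1}$; the state and control constraints are taken to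 be inactive, so that $U_{k|i}=\mathcal M(x_{k,1},U_{k|i-1})$. The first block of the final iterate is applied as $u_{k+1}$. Lagrangian of the nonlinear program (minimize $\tfrac12x_\ell^TPx_\ell+\tfrac12\sum_{j=1}^{\ell-1}(x_j^TQx_j+u_j^TRu_j)$ subject to $x_{j+1}=f(x_j,u_j)$, $x_1=x_{k,1}$): with $x_1=x_{k,1}$ held fixed, free states $X=(x_2,\ldots,x_\ell)$, controls $U=(u_1,\ldots,u_{\ell-1})$ and costates $\Lambda=(\lambda_2,\ldots,\lambda_\ell)$, $$\mathcal L(X,U,\Lambda)=\tfrac12x_\ell^TPx_\ell+\tfrac12\sum_{j=1}^{\ell-1}(x_j^TQx_j+u_j^TRu_j)+\sum_{j=1}^{\ell-1}\lambda_{j+1}^T\big(f(x_j,u_j)-x_{j+1}\big).$$ $\nabla_{(X,U)}$ is the gradient with respect to the free variables $x_2,\ldots,x_\ell,u_1,\ldots,u_{\ell-1}$. *)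

(* Defs.v *)
From HB Require Import structures.
From mathcomp Require Import all_boot all_order all_algebra.
From mathcomp Require Import all_classical all_reals all_analysis.
From mathcomp Require Import complex.
Import Order.TTheory GRing.Theory Num.Theory.
Import numFieldNormedType.Exports.

Set Implicit Arguments.
Unset Strict Implicit.
Unset Printing Implicit Defensive.

Local Open Scope classical_set_scope.
Local Open Scope ring_scope.

(* The library norm `|v| on matrices is the max norm, hence the Euclidean and
   induced norms below. *)
Definition enorm (R : realType) (d : nat) (v : 'cV[R]_d) : R :=
  Num.sqrt (\sum_i v i 0 ^+ 2).

Definition opnorm (R : realType) (p q : nat) (M : 'M[R]_(p, q)) : R :=
  sup [set enorm (M *m v) | v in [set v : 'cV[R]_q | enorm v <= 1]].

Definition qform (R : realType) (d : nat) (M : 'M[R]_d) (v : 'cV[R]_d) : R :=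
  (v^T *m M *m v) 0 0.

Definition sym_psd (R : realType) (d : nat) (M : 'M[R]_d) : Prop :=
  M^T = M /\ forall v, 0 <= qform M v.

Definition sym_pd (R : realType) (d : nat) (M : 'M[R]_d) : Prop :=
  M^T = M /\ forall v, v != 0 -> 0 < qform M v.

Definition schur_stable (R : realType) (d : nat) (M : 'M[R]_d) : Prop :=
  forall z : R[i],
    eigenvalue (map_mx (real_complex R) M) z -> `|z| < 1.

(* The domain is finite dimensional, so continuity of every directional
   differential p |-> 'd F p v is continuity of p |-> 'd F p. *)
Definition continuously_differentiable (R : realType) (V W : normedModType R)
    (F : V -> W) : Prop :=
  (forall p, differentiable F p) /\
  (forall v, continuous (fun p => 'd F p v)).

Definition gradient (R : realType) (d : nat) (F : 'cV[R]_d -> R)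
    (z : 'cV[R]_d) : 'cV[R]_d :=
  \col_i 'D_(delta_mx i 0) F z.

(* Block j of a stacked vector; blocks are numbered from 1, and j is only
   meant to range over 1, ..., p. *)
Definition blk (R : realType) (p d : nat) (s : 'cV[R]_(\sum_(i < p) d))
    (j : nat) : 'cV[R]_d :=
  if insub j.-1 is Some i then submxcol s i else 0.

(* Riccati equation with input weight 2 Rw and state weight 2 Q; P is
   stabilizing when the associated closed-loop matrix is Schur. *)
Definition riccati_gain (R : realType) (n m : nat) (A0 : 'M[R]_n)
    (B0 : 'M[R]_(n, m)) (Rw : 'M[R]_m) (P : 'M[R]_n) : 'M[R]_(m, n) :=
  invmx (2 *: Rw + B0^T *m P *m B0) *m B0^T *m P *m A0.

Definition stabilizing_dare_solution (R : realType) (n m : nat) (A0 : 'M[R]_n)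
    (B0 : 'M[R]_(n, m)) (Q : 'M[R]_n) (Rw : 'M[R]_m) (P : 'M[R]_n) : Prop :=
  P = A0^T *m P *m A0
      - A0^T *m P *m B0 *m invmx (2 *: Rw + B0^T *m P *m B0)
          *m B0^T *m P *m A0
      + 2 *: Q
  /\ schur_stable (A0 - B0 *m riccati_gain A0 B0 Rw P).

Definition dyn (R : realType) (n m : nat)
    (A : 'cV[R]_n -> 'cV[R]_m -> 'M[R]_n)
    (B : 'cV[R]_n -> 'cV[R]_m -> 'M[R]_(n, m))
    (x : 'cV[R]_n) (u : 'cV[R]_m) : 'cV[R]_n :=
  A x u *m x + B x u *m u.

Fixpoint rollout_from (R : realType) (n m : nat)
    (A : 'cV[R]_n -> 'cV[R]_m -> 'M[R]_n)
    (B : 'cV[R]_n -> 'cV[R]_m -> 'M[R]_(n, m))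
    (xi : 'cV[R]_n) (u : nat -> 'cV[R]_m) (i : nat) : 'cV[R]_n :=
  if i is i'.+1 then dyn A B (rollout_from A B xi u i') (u i) else xi.

(* rollout A B xi U j is x_j(xi, U): x_1 = xi and x_{j+1} = f(x_j, u_j), with
   j >= 1. *)
Definition rollout (R : realType) (n m p : nat)
    (A : 'cV[R]_n -> 'cV[R]_m -> 'M[R]_n)
    (B : 'cV[R]_n -> 'cV[R]_m -> 'M[R]_(n, m))
    (xi : 'cV[R]_n) (U : 'cV[R]_(\sum_(i < p) m)) (j : nat) : 'cV[R]_n :=
  rollout_from A B xi (blk U) j.-1.

Definition frozenA (R : realType) (n m p : nat)
    (A : 'cV[R]_n -> 'cV[R]_m -> 'M[R]_n)
    (B : 'cV[R]_n -> 'cV[R]_m -> 'M[R]_(n, m))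
    (xi : 'cV[R]_n) (U : 'cV[R]_(\sum_(i < p) m)) (j : nat) : 'M[R]_n :=
  A (rollout A B xi U j) (blk U j).

Definition frozenB (R : realType) (n m p : nat)
    (A : 'cV[R]_n -> 'cV[R]_m -> 'M[R]_n)
    (B : 'cV[R]_n -> 'cV[R]_m -> 'M[R]_(n, m))
    (xi : 'cV[R]_n) (U : 'cV[R]_(\sum_(i < p) m)) (j : nat) : 'M[R]_(n, m) :=
  B (rollout A B xi U j) (blk U j).

(* A_{b-1} A_{b-2} ... A_a, in this order; the identity if b <= a. *)
Definition transition (R : realType) (n : nat) (As : nat -> 'M[R]_n)
    (a b : nat) : 'M[R]_n :=
  \big[mulmx/1%:M]_(j <- rev (index_iota a b)) As j.

Definition calQ (R : realType) (n ell : nat) (Q P : 'M[R]_n) :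
    'M[R]_(\sum_(i < ell) n) :=
  \mxdiag_(i < ell) (if i.+1 == ell then P else Q).

Definition calR (R : realType) (m ell : nat) (Rw : 'M[R]_m) :
    'M[R]_(\sum_(i < ell.-1) m) :=
  \mxdiag_(i < ell.-1) Rw.

(* Ordinals i, r, c below stand for the block numbers i+1, r+1, c+1. *)
Definition Phi (R : realType) (n m ell : nat)
    (A : 'cV[R]_n -> 'cV[R]_m -> 'M[R]_n)
    (B : 'cV[R]_n -> 'cV[R]_m -> 'M[R]_(n, m))
    (xi : 'cV[R]_n) (U : 'cV[R]_(\sum_(i < ell.-1) m)) :
    'M[R]_(\sum_(i < ell) n, n) :=
  \mxcol_(i < ell) transition (frozenA A B xi U) 1 i.+1.

Definition Gamma_block (R : realType) (n m ell : nat)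
    (A : 'cV[R]_n -> 'cV[R]_m -> 'M[R]_n)
    (B : 'cV[R]_n -> 'cV[R]_m -> 'M[R]_(n, m))
    (xi : 'cV[R]_n) (U : 'cV[R]_(\sum_(i < ell.-1) m)) (r c : nat) :
    'M[R]_(n, m) :=
  if (c < r)%N
  then transition (frozenA A B xi U) c.+1 r *m frozenB A B xi U c
  else 0.

Definition Gamma (R : realType) (n m ell : nat)
    (A : 'cV[R]_n -> 'cV[R]_m -> 'M[R]_n)
    (B : 'cV[R]_n -> 'cV[R]_m -> 'M[R]_(n, m))
    (xi : 'cV[R]_n) (U : 'cV[R]_(\sum_(i < ell.-1) m)) :
    'M[R]_(\sum_(i < ell) n, \sum_(i < ell.-1) m) :=
  \mxblock_(r < ell, c < ell.-1) Gamma_block A B xi U r.+1 c.+1.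

Definition calH (R : realType) (n m ell : nat)
    (A : 'cV[R]_n -> 'cV[R]_m -> 'M[R]_n)
    (B : 'cV[R]_n -> 'cV[R]_m -> 'M[R]_(n, m))
    (Q : 'M[R]_n) (Rw : 'M[R]_m) (P : 'M[R]_n)
    (xi : 'cV[R]_n) (U : 'cV[R]_(\sum_(i < ell.-1) m)) :
    'M[R]_(\sum_(i < ell.-1) m) :=
  calR ell Rw + (Gamma A B xi U)^T *m calQ ell Q P *m Gamma A B xi U.

Definition calM (R : realType) (n m ell : nat)
    (A : 'cV[R]_n -> 'cV[R]_m -> 'M[R]_n)
    (B : 'cV[R]_n -> 'cV[R]_m -> 'M[R]_(n, m))
    (Q : 'M[R]_n) (Rw : 'M[R]_m) (P : 'M[R]_n)
    (xi : 'cV[R]_n) (U : 'cV[R]_(\sum_(i < ell.-1) m)) :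
    'cV[R]_(\sum_(i < ell.-1) m) :=
  - (invmx (calH A B Q Rw P xi U)
     *m (Gamma A B xi U)^T *m calQ ell Q P *m Phi A B xi U *m xi).

(* Closed loop: Us k i is U_{k|i} (i >= 1), and N k is the index of the final
   iterate at step k, which may vary with k. *)
Record iscd_mpc (R : realType) (n m ell : nat)
    (A : 'cV[R]_n -> 'cV[R]_m -> 'M[R]_n)
    (B : 'cV[R]_n -> 'cV[R]_m -> 'M[R]_(n, m))
    (Q : 'M[R]_n) (Rw : 'M[R]_m) (P : 'M[R]_n)
    (x : nat -> 'cV[R]_n) (u : nat -> 'cV[R]_m)
    (N : nat -> nat) (Us : nat -> nat -> 'cV[R]_(\sum_(i < ell.-1) m)) :
    Prop := ISCDMPC {
  iscd_system : forall k, x k.+1 = dyn A B (x k) (u k);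
  iscd_final : forall k, (1 <= N k)%N;
  iscd_iterates : forall k i, (1 <= i < N k)%N ->
    Us k i.+1 = calM A B Q Rw P (dyn A B (x k) (u k)) (Us k i);
  iscd_input : forall k, u k.+1 = blk (Us k (N k)) 1
}.

(* X stacks x_2, ..., x_ell, so that x_{j+1} is its j-th block; x_1 = xi is
   held fixed.  Likewise Lam stacks lambda_2, ..., lambda_ell. *)
Definition pred_state (R : realType) (n p : nat) (xi : 'cV[R]_n)
    (X : 'cV[R]_(\sum_(i < p) n)) (j : nat) : 'cV[R]_n :=
  if (j <= 1)%N then xi else blk X j.-1.

Definition lagrangian (R : realType) (n m ell : nat)
    (A : 'cV[R]_n -> 'cV[R]_m -> 'M[R]_n)
    (B : 'cV[R]_n -> 'cV[R]_m -> 'M[R]_(n, m))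
    (Q : 'M[R]_n) (Rw : 'M[R]_m) (P : 'M[R]_n) (xi : 'cV[R]_n)
    (X : 'cV[R]_(\sum_(i < ell.-1) n)) (U : 'cV[R]_(\sum_(i < ell.-1) m))
    (Lam : 'cV[R]_(\sum_(i < ell.-1) n)) : R :=
  let x := pred_state xi X in
  let u := blk U in
  let lam j := blk Lam j.-1 in
  2^-1 * qform P (x ell)
  + 2^-1 * (\sum_(1 <= j < ell) (qform Q (x j) + qform Rw (u j)))
  + \sum_(1 <= j < ell)
      ((lam j.+1)^T *m (dyn A B (x j) (u j) - x j.+1)) 0 0.

Definition grad_XU_lagrangian (R : realType) (n m ell : nat)
    (A : 'cV[R]_n -> 'cV[R]_m -> 'M[R]_n)
    (B : 'cV[R]_n -> 'cV[R]_m -> 'M[R]_(n, m))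
    (Q : 'M[R]_n) (Rw : 'M[R]_m) (P : 'M[R]_n) (xi : 'cV[R]_n)
    (X : 'cV[R]_(\sum_(i < ell.-1) n)) (U : 'cV[R]_(\sum_(i < ell.-1) m))
    (Lam : 'cV[R]_(\sum_(i < ell.-1) n)) :
    'cV[R]_(\sum_(i < ell.-1) n + \sum_(i < ell.-1) m) :=
  gradient (fun z => lagrangian A B Q Rw P xi (usubmx z) (dsubmx z) Lam)
           (col_mx X U).

(* Main.v *)
Require Import Defs.
From HB Require Import structures.
From mathcomp Require Import all_boot all_order all_algebra.
From mathcomp Require Import all_classical all_reals all_analysis.
From mathcomp Require Import ring lra zify.
Import Order.TTheory GRing.Theory Num.Theory.
Import numFieldNormedType.Exports.

Local Open Scope ring_scope.

Set Implicit Arguments.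
Unset Strict Implicit.
Unset Printing Implicit Defensive.

(** A fixed point of the iteration map is a stationary point of the
    linear-quadratic program whose coefficients are frozen along its own
    rollout.  The gradient of the true Lagrangian at that point therefore only
    sees the derivatives of the coefficients A and B, and these are controlled
    by the Lipschitz constants.

    Stationarity.  The input weight makes the Hessian of the frozen program
    definite ([calH_unit]), so the fixed-point equation is equivalent to the
    normal equation R U + Gamma^T Q (Gamma U + Phi xi) = 0.  The frozen
    prediction Gamma U + Phi xi is the rollout itself
    ([prediction_rollout]), and the blocks of Gamma^T Q X are the costates
    multiplied by B_j^T ([costate_unroll]).  Hence
    R u_j + B_j^T lambda_(j+1) = 0 ([fixed_point_stationary]).

    Increment.  Move the Lagrangian by h w, with state part y and control part
    v.  With frozen coefficients it is quadratic, and its linear part vanishes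
    by the costate and stationarity equations.  What is left is h^2 q plus the
    sum of the products of lambda_(j+1) with the variation of the coefficients
    ([seq_lagrangian_increment]).  By the Lipschitz bounds that variation is
    at most max(L_A, L_B) |h| (|y_j| + |v_j|) (|x_j| + |u_j| + O(h))
    ([coef_variation_le]), so no derivative of A or B has to be computed.

    Conclusion.  The Lagrangian is differentiable, so its derivative in the
    direction of its gradient g is |g|^2 ([gradient_dotc]).  Passing to the
    limit in the increment with w = g ([derive_le]), and using
    |y_j| + |v_j| <= sqrt 2 |g| ([stage_norm_le]), bounds |g|^2 by |g| times
    the announced right-hand side. *)

(** * Euclidean and induced norms *)

Definition dotc (R : realType) (d : nat) (a b : 'cV[R]_d) : R :=
  (a^T *m b) 0 0.

Section Dot.
Variable R : realType.

Lemma dotcE d (a b : 'cV[R]_d) : dotc a b = \sum_i a i 0 * b i 0.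
Proof. by rewrite /dotc mxE; apply: eq_bigr => i _; rewrite mxE. Qed.

Lemma dotcC d (a b : 'cV[R]_d) : dotc a b = dotc b a.
Proof. by rewrite !dotcE; apply: eq_bigr => i _; rewrite mulrC. Qed.

Lemma dotcDr d (a b c : 'cV[R]_d) : dotc a (b + c) = dotc a b + dotc a c.
Proof. by rewrite /dotc mulmxDr mxE. Qed.

Lemma dotcDl d (a b c : 'cV[R]_d) : dotc (a + b) c = dotc a c + dotc b c.
Proof. by rewrite dotcC dotcDr !(dotcC c). Qed.

Lemma dotcZr d (a b : 'cV[R]_d) h : dotc a (h *: b) = h * dotc a b.
Proof. by rewrite /dotc -scalemxAr mxE. Qed.

Lemma dotcZl d (a b : 'cV[R]_d) h : dotc (h *: a) b = h * dotc a b.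
Proof. by rewrite dotcC dotcZr dotcC. Qed.

Lemma dotcNr d (a b : 'cV[R]_d) : dotc a (- b) = - dotc a b.
Proof. by rewrite -scaleN1r dotcZr mulN1r. Qed.

Lemma dotc0r d (a : 'cV[R]_d) : dotc a 0 = 0.
Proof. by rewrite /dotc mulmx0 mxE. Qed.

Lemma dotc_mulmx p q (a : 'cV[R]_p) (M : 'M[R]_(p, q)) b :
  dotc a (M *m b) = dotc (M^T *m a) b.
Proof. by rewrite /dotc trmx_mul trmxK mulmxA. Qed.

Lemma qformE d (M : 'M[R]_d) v : qform M v = dotc v (M *m v).
Proof. by rewrite /qform /dotc mulmxA. Qed.

Lemma dotc_ge0 d (v : 'cV[R]_d) : 0 <= dotc v v.
Proof. by rewrite dotcE sumr_ge0// => i _; rewrite -expr2 sqr_ge0. Qed.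

Lemma dotc_eq0 d (v : 'cV[R]_d) : dotc v v = 0 -> v = 0.
Proof.
rewrite dotcE => /eqP; rewrite psumr_eq0; last by move=> i _; rewrite -expr2 sqr_ge0.
move=> /allP v0; apply/colP => i; rewrite mxE.
by apply/eqP; rewrite -sqrf_eq0 expr2; apply: (v0 i); rewrite mem_index_enum.
Qed.

Lemma enorm_ge0 d (v : 'cV[R]_d) : 0 <= enorm v.
Proof. exact: sqrtr_ge0. Qed.

Lemma sqr_enorm d (v : 'cV[R]_d) : enorm v ^+ 2 = dotc v v.
Proof.
rewrite sqr_sqrtr; first by rewrite dotcE; apply: eq_bigr => i _; rewrite expr2.
by rewrite sumr_ge0// => i _; rewrite sqr_ge0.
Qed.

Lemma enorm_eq0 d (v : 'cV[R]_d) : enorm v = 0 -> v = 0.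
Proof. by move=> v0; apply: dotc_eq0; rewrite -sqr_enorm v0 expr0n. Qed.

Lemma enormZ d (v : 'cV[R]_d) h : enorm (h *: v) = `|h| * enorm v.
Proof.
apply/eqP; rewrite -(@eqrXn2 _ 2)// ?enorm_ge0 ?mulr_ge0 ?enorm_ge0//.
by rewrite exprMn !sqr_enorm dotcZl dotcZr mulrA real_normK ?num_real// expr2.
Qed.

Lemma enorm0 d : enorm (0 : 'cV[R]_d) = 0.
Proof. by rewrite -(scale0r 0) enormZ normr0 mul0r. Qed.

(** Cauchy-Schwarz, from 0 <= |(a . b) a - (a . a) b|^2, which is a . a times
    the difference of the two squared sides. *)
Lemma dotc_le d (a b : 'cV[R]_d) : `|dotc a b| <= enorm a * enorm b.
Proof.
rewrite -(@ler_pXn2r _ 2)// ?nnegrE ?mulr_ge0 ?enorm_ge0//.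
rewrite exprMn !sqr_enorm real_normK ?num_real//.
have [a0|a0] := eqVneq (dotc a a) 0.
  by rewrite (dotc_eq0 a0) dotcC !dotc0r expr0n mul0r.
have apos : 0 < dotc a a by rewrite lt_def a0 dotc_ge0.
have := dotc_ge0 (dotc a b *: a + - dotc a a *: b).
rewrite !(dotcDl, dotcDr, dotcZl, dotcZr) (dotcC b a) => h.
rewrite -subr_ge0 -(pmulr_rge0 _ apos); lra.
Qed.

Lemma enormD d (a b : 'cV[R]_d) : enorm (a + b) <= enorm a + enorm b.
Proof.
rewrite -(@ler_pXn2r _ 2)// ?nnegrE ?addr_ge0 ?enorm_ge0//.
rewrite sqrrD !sqr_enorm !(dotcDl, dotcDr) (dotcC b a).
have := le_trans (ler_norm _) (dotc_le a b); lra.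
Qed.

Lemma enorm_sum d (I : Type) (r : seq I) (F : I -> 'cV[R]_d) :
  enorm (\sum_(i <- r) F i) <= \sum_(i <- r) enorm (F i).
Proof.
elim/big_ind2 : _ => [|a x b y ha hb|//].
  by rewrite enorm0.
by apply: le_trans (enormD _ _) _; apply: lerD.
Qed.

(** The supremum defining [opnorm] is over a set bounded by the sum of the
    norms of the columns. *)
Lemma enorm_mulmx p q (M : 'M[R]_(p, q)) v :
  enorm (M *m v) <= opnorm M * enorm v.
Proof.
have bounded w : enorm w <= 1 -> enorm (M *m w) <= \sum_i enorm (col i M).
  (* column i is scaled by w_i, and |w_i| <= |w| <= 1 *)
  move=> w1; have -> : M *m w = \sum_i w i 0 *: col i M.
    apply/colP => i; rewrite !mxE summxE; apply: eq_bigr => j _.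
    by rewrite !mxE mulrC.
  apply: le_trans (enorm_sum _ _) _; apply: ler_sum => i _.
  rewrite enormZ ler_piMl ?enorm_ge0//; apply: le_trans w1.
  rewrite -(@ler_pXn2r _ 2)// ?nnegrE ?enorm_ge0//.
  rewrite real_normK ?num_real// sqr_enorm dotcE (bigD1 i)//= -expr2 lerDl.
  by rewrite sumr_ge0// => j _; rewrite -expr2 sqr_ge0.
have [v0|vn0] := eqVneq (enorm v) 0.
  by rewrite (enorm_eq0 v0) mulmx0 !enorm0 mulr0.
have vpos : 0 < enorm v by rewrite lt_def vn0 enorm_ge0.
rewrite -ler_pdivrMr//.
have -> : enorm (M *m v) / enorm v = enorm (M *m ((enorm v)^-1 *: v)).
  by rewrite -scalemxAr enormZ ger0_norm ?invr_ge0 ?enorm_ge0// mulrC.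
apply: ub_le_sup.
  by exists (\sum_i enorm (col i M)) => _ [w w1 <-]; apply: bounded.
exists ((enorm v)^-1 *: v) => //=.
by rewrite enormZ ger0_norm ?invr_ge0 ?enorm_ge0// mulVf.
Qed.

(** * Blocks of stacked vectors *)

Lemma dotc_blk p d (s t : 'cV[R]_(\sum_(i < p) d)) :
  dotc s t = \sum_(i < p) dotc (submxcol s i) (submxcol t i).
Proof.
rewrite /dotc -[s in LHS]submxcolK -[t in LHS]submxcolK tr_mxcol.
by rewrite mul_mxrow_mxcol summxE.
Qed.

Lemma blkE p d (s : 'cV[R]_(\sum_(i < p) d)) (i : 'I_p) :
  blk s i.+1 = submxcol s i.
Proof. by rewrite /blk /= valK. Qed.

Lemma blk_mxcol p d (F : nat -> 'cV[R]_d) j : (1 <= j <= p)%N ->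
  blk (\mxcol_(i < p) F i) j = F j.-1.
Proof. by case: j => // j /= jp; rewrite -[j.+1]/((Ordinal jp).+1) blkE mxcolK. Qed.

Lemma blkD p d (s t : 'cV[R]_(\sum_(i < p) d)) j : blk (s + t) j = blk s j + blk t j.
Proof. by rewrite /blk; case: insub => [i|]; rewrite ?addr0 ?submxcolD. Qed.

Lemma blkZ p d (s : 'cV[R]_(\sum_(i < p) d)) h j : blk (h *: s) j = h *: blk s j.
Proof.
rewrite /blk; case: insub => [i|]; rewrite ?scaler0//.
by apply/matrixP => a b; rewrite !mxE.
Qed.

Lemma dotc_blk_le p d (s : 'cV[R]_(\sum_(i < p) d)) j :
  dotc (blk s j) (blk s j) <= dotc s s.
Proof.
rewrite /blk; case: insub => [i|]; last by rewrite dotc0r dotc_ge0.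
by rewrite dotc_blk (bigD1 i)//= lerDl sumr_ge0// => k _; apply: dotc_ge0.
Qed.

Lemma dotc_col_mx p q (a c : 'cV[R]_p) (b e : 'cV[R]_q) :
  dotc (col_mx a b) (col_mx c e) = dotc a c + dotc b e.
Proof. by rewrite /dotc tr_col_mx mul_row_col mxE. Qed.

End Dot.

(** * Stationarity of the fixed point for the frozen problem *)

Section Stationarity.
Variables (R : realType) (n m : nat).
Variables (A : 'cV[R]_n -> 'cV[R]_m -> 'M[R]_n).
Variables (B : 'cV[R]_n -> 'cV[R]_m -> 'M[R]_(n, m)).
Variables (Q : 'M[R]_n) (Rw : 'M[R]_m) (P : 'M[R]_n).
Implicit Types (As : nat -> 'M[R]_n).

Lemma transition_id As a : transition As a a = 1%:M.
Proof. by rewrite /transition /index_iota subnn big_nil. Qed.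

Lemma transition_recr As a b : (a <= b)%N ->
  transition As a b.+1 = As b *m transition As a b.
Proof.
move=> ab; rewrite /transition /index_iota subSn// -addn1 iotaD subnKC//.
by rewrite rev_cat big_cons.
Qed.

Lemma transition_recl As a b : (a < b)%N ->
  transition As a b = transition As a.+1 b *m As a.
Proof.
elim: b => // b IHb; rewrite ltnS leq_eqVlt => /predU1P[<-|ab].
  by rewrite transition_recr// !transition_id mulmx1 mul1mx.
by rewrite (transition_recr _ (ltnW ab)) (transition_recr _ ab) IHb// mulmxA.
Qed.

Lemma rolloutS p xi (U : 'cV[R]_(\sum_(i < p) m)) j : (0 < j)%N ->
  rollout A B xi U j.+1 = dyn A B (rollout A B xi U j) (blk U j).
Proof. by case: j. Qed.

(** Variation of constants: driven by the input that generates it, the rollout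
    is a trajectory of the linear dynamics frozen along it. *)
Lemma rollout_frozen p xi (U : 'cV[R]_(\sum_(i < p) m)) r :
  rollout A B xi U r.+1 = transition (frozenA A B xi U) 1 r.+1 *m xi
    + \sum_(0 <= c < r) transition (frozenA A B xi U) c.+2 r.+1
        *m (frozenB A B xi U c.+1 *m blk U c.+1).
Proof.
elim: r => [|r IHr]; first by rewrite transition_id mul1mx big_geq// addr0.
rewrite rolloutS// /dyn -/(frozenA A B xi U r.+1) -/(frozenB A B xi U r.+1).
rewrite IHr big_nat_recr//= transition_id mul1mx [in RHS]transition_recr// mulmxDr.
rewrite mulmxA -addrA; congr (_ + (_ + _)).
rewrite mulmx_sumr !big_nat; apply: eq_bigr => c /andP[_ cr].
by rewrite [in RHS]transition_recr ?mulmxA.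
Qed.

Lemma prediction_rollout ell xi (U : 'cV[R]_(\sum_(i < ell.-1) m)) :
  Gamma (ell := ell) A B xi U *m U + Phi (ell := ell) A B xi U *m xi
  = \mxcol_(r < ell) rollout A B xi U r.+1.
Proof.
rewrite -[U in _ *m U]submxcolK mul_mxblock_mxrow mxcol_mul.
apply/mxcolP => r; rewrite submxcolD !mxcolK rollout_frozen addrC; congr (_ + _).
have rl : (r <= ell.-1)%N by case: ell U r => [U []|? ? r]//=; rewrite -ltnS.
rewrite (big_nat_widen _ _ ell.-1)// big_mkord [RHS]big_mkcond/=.
apply: eq_bigr => c _; rewrite /Gamma_block ltnS; case: ifP => _; last by rewrite mul0mx.
by rewrite blkE mulmxA.
Qed.

(** The adjoint counterpart of [rollout_frozen]: unrolling the backward costate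
    recursion expresses a costate through the later states, which is the shape
    in which Gamma^T Q X produces it. *)
Lemma costate_unroll As (xs lam : nat -> 'cV[R]_n) ell :
  lam ell = P *m xs ell ->
  (forall j, (2 <= j < ell)%N -> lam j = Q *m xs j + (As j)^T *m lam j.+1) ->
  forall j, (2 <= j <= ell)%N ->
  lam j = \sum_(j <= r < ell.+1)
            (transition As j r)^T *m ((if r == ell then P else Q) *m xs r).
Proof.
move=> lamN lamS j /andP[j2 jl]; rewrite -(subKn jl).
(* induction on the distance d = ell - j to the terminal costate *)
have : (ell - j <= ell - 2)%N by rewrite leq_sub2l.
elim: (ell - j)%N => [_|d IHd dl].
  by rewrite subn0 big_nat1 transition_id trmx1 mul1mx eqxx.
have step : (ell - d = (ell - d.+1).+1)%N by lia.
rewrite lamS; last by lia.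
rewrite -step IHd; last by lia.
rewrite [in RHS]big_ltn; last by lia.
rewrite transition_id trmx1 mul1mx -step.
case: eqP => [|_]; first by lia.
congr (_ + _); rewrite mulmx_sumr !big_nat; apply: eq_bigr => r /andP[dr _].
by rewrite [in RHS]transition_recl -?step// trmx_mul !mulmxA.
Qed.

(** A kernel vector v satisfies v^T H v = 0; both terms of this form are
    nonnegative, and the input weight alone forces every block of v to be 0. *)
Lemma calH_unit ell xi (U : 'cV[R]_(\sum_(i < ell.-1) m)) :
  sym_psd Q -> sym_pd Rw -> sym_pd P ->
  calH (ell := ell) A B Q Rw P xi U \in unitmx.
Proof.
move=> [_ Q0] [_ R0] [_ P0]; rewrite -row_free_unit -kermx_eq0.
apply/eqP/row_matrixP => i; rewrite row0; set w := row i _.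
have : w *m calH (ell := ell) A B Q Rw P xi U = 0 by rewrite /w -row_mul mulmx_ker row0.
pose v := w^T; rewrite -[w]trmxK -/v => vH.
suff -> : v = 0 by rewrite trmx0.
have: dotc v (calH (ell := ell) A B Q Rw P xi U *m v) = 0.
  by rewrite /dotc mulmxA vH mul0mx mxE.
rewrite /calH mulmxDl dotcDr -!mulmxA [X in _ + X]dotc_mulmx trmxK.
set y := Gamma _ _ _ _ *m v.
have yQ : 0 <= dotc y (calQ ell Q P *m y).
  rewrite dotc_blk sumr_ge0// => r _.
  rewrite -[y in _ *m y]submxcolK mul_mxdiag_mxcol mxcolK -qformE.
  case: ifP => _; last exact: Q0.
  have [->|/P0/ltW//] := eqVneq (submxcol y r) 0.
  by rewrite qformE mulmx0 dotc0r.
have R0' (z : 'cV[R]_m) : 0 <= dotc z (Rw *m z).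
  have [->|/R0/ltW] := eqVneq z 0; first by rewrite mulmx0 dotc0r.
  by rewrite qformE.
have vR : dotc v (calR ell Rw *m v)
    = \sum_(i < ell.-1) dotc (submxcol v i) (Rw *m submxcol v i).
  rewrite dotc_blk; apply: eq_bigr => c _.
  by rewrite -[v in _ *m v]submxcolK mul_mxdiag_mxcol mxcolK.
have vR0 : 0 <= dotc v (calR ell Rw *m v) by rewrite vR sumr_ge0.
move=> /eqP; rewrite paddr_eq0// => /andP[+ _].
rewrite vR psumr_eq0// => /allP vz.
apply/mxcolP => c; rewrite submxcol0; apply/eqP/negP => /negP cn0.
by have := R0 _ cn0; rewrite qformE (eqP (vz c _)) ?ltxx ?mem_index_enum.
Qed.

(** This is the normal equation R U + Gamma^T Q (Gamma U + Phi xi) = 0 of the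
    frozen program, read block by block: Gamma U + Phi xi is the rollout, and
    block j of Gamma^T Q X is B_j^T times the costate of stage j + 1. *)
Lemma fixed_point_stationary ell xi (U : 'cV[R]_(\sum_(i < ell.-1) m))
    (lam : nat -> 'cV[R]_n) :
  sym_psd Q -> sym_pd Rw -> sym_pd P ->
  calM (ell := ell) A B Q Rw P xi U = U ->
  let xs := rollout A B xi U in
  lam ell = P *m xs ell ->
  (forall j, (2 <= j < ell)%N ->
     lam j = Q *m xs j + (frozenA A B xi U j)^T *m lam j.+1) ->
  forall j, (1 <= j < ell)%N ->
  Rw *m blk U j + (frozenB A B xi U j)^T *m lam j.+1 = 0.
Proof.
move=> hQ hR hP fixU xs lamN lamS j /andP[j1 jl].
have normal : calR ell Rw *m U + (Gamma A B xi U)^T *m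
    (calQ ell Q P *m (\mxcol_(r < ell) xs r.+1)) = 0.
  rewrite -prediction_rollout !mulmxDr addrA !mulmxA -mulmxDl.
  rewrite -/(calH A B Q Rw P xi U) -[U in _ *m U + _]fixU /calM mulmxN -!mulmxA.
  by rewrite mulKVmx ?calH_unit// addNr.
have cl : (j.-1 < ell.-1)%N by lia.
have /(congr1 (fun s => submxcol s (Ordinal cl))) := normal.
rewrite submxcol0 submxcolD mul_mxdiag_mxcol tr_mxblock mul_mxblock_mxrow !mxcolK.
rewrite -[U in calR _ _ *m U]submxcolK mul_mxdiag_mxcol mxcolK -blkE /= prednK//.
move=> <-; congr (_ + _); rewrite (costate_unroll lamN lamS); last by lia.
(* the sum over r >= j is the one over all blocks r: Gamma is block lower
   triangular, with zero blocks above *)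
rewrite mulmx_sumr big_add1 /= (big_nat_widenl j 0)// big_mkord big_mkcond /=.
apply: eq_bigr => r _; rewrite /Gamma_block ltnS.
case: ifP => jr; last by rewrite trmx0 mul0mx.
by rewrite trmx_mul -mulmxA.
Qed.

End Stationarity.


(** * Increments of the Lagrangian *)

Section Increment.
Variables (R : realType) (n m : nat).
Variables (A : 'cV[R]_n -> 'cV[R]_m -> 'M[R]_n).
Variables (B : 'cV[R]_n -> 'cV[R]_m -> 'M[R]_(n, m)).
Variables (Q : 'M[R]_n) (Rw : 'M[R]_m) (P : 'M[R]_n).

(** [lagrangian] as a function of sequences of states, controls and costates,
    so that increments and differentiability are treated stage by stage,
    without the stacking of the variables. *)
Definition seq_lagrangian ell (x : nat -> 'cV[R]_n) (u : nat -> 'cV[R]_m)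
    (lam : nat -> 'cV[R]_n) : R :=
  2^-1 * qform P (x ell)
  + 2^-1 * (\sum_(1 <= j < ell) (qform Q (x j) + qform Rw (u j)))
  + \sum_(1 <= j < ell) dotc (lam j.+1) (dyn A B (x j) (u j) - x j.+1).

(** The error made by freezing the coefficients at (x, u): it is what separates
    the true dynamics from the linear model used by the iteration. *)
Definition coef_variation x u dx du : 'cV[R]_n :=
  (A (x + dx) (u + du) - A x u) *m (x + dx)
  + (B (x + dx) (u + du) - B x u) *m (u + du).

Lemma qform_increment d (M : 'M[R]_d) x y h : M^T = M ->
  qform M (x + h *: y)
  = qform M x + 2 * (h * dotc (M *m x) y) + h ^+ 2 * qform M y.
Proof.
move=> symM; rewrite !qformE mulmxDr -scalemxAr.
rewrite !(dotcDl, dotcDr, dotcZl, dotcZr) (dotcC y (M *m x)).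
rewrite (dotc_mulmx x M y) symM; ring.
Qed.

(** Once the coefficients are frozen at the base point the Lagrangian is
    quadratic, and the costate and stationarity equations cancel its linear
    part by summation by parts; what remains beside the second-order term is
    the variation of the coefficients, weighted by the costates. *)
Lemma seq_lagrangian_increment ell (x y lam : nat -> 'cV[R]_n)
    (u v : nat -> 'cV[R]_m) h :
  Q^T = Q -> Rw^T = Rw -> P^T = P -> (1 <= ell)%N ->
  lam ell = P *m x ell ->
  (forall j, (2 <= j < ell)%N ->
     lam j = Q *m x j + (A (x j) (u j))^T *m lam j.+1) ->
  (forall j, (1 <= j < ell)%N ->
     Rw *m u j + (B (x j) (u j))^T *m lam j.+1 = 0) ->
  y 1%N = 0 ->
  seq_lagrangian ell (fun j => x j + h *: y j) (fun j => u j + h *: v j) lam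
    - seq_lagrangian ell x u lam
  = h ^+ 2 * (2^-1 * qform P (y ell)
              + 2^-1 * \sum_(1 <= j < ell) (qform Q (y j) + qform Rw (v j)))
    + \sum_(1 <= j < ell)
        dotc (lam j.+1) (coef_variation (x j) (u j) (h *: y j) (h *: v j)).
Proof.
move=> symQ symR symP ell1 lamN lamS statU y1.
(* y 1 = 0: the initial state is held fixed, so there is no boundary term at 1 *)
have byparts : \sum_(1 <= j < ell) (dotc (lam j) (y j) - dotc (lam j.+1) (y j.+1))
    = - dotc (lam ell) (y ell).
  under eq_bigr => j _ do rewrite -opprB.
  by rewrite sumrN telescope_sumr// y1 dotc0r subr0.
suff stage j : (1 <= j < ell)%N ->
    2^-1 * (qform Q (x j + h *: y j) + qform Rw (u j + h *: v j))
    + dotc (lam j.+1) (dyn A B (x j + h *: y j) (u j + h *: v j)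
                       - (x j.+1 + h *: y j.+1))
  = 2^-1 * (qform Q (x j) + qform Rw (u j))
    + dotc (lam j.+1) (dyn A B (x j) (u j) - x j.+1)
    + h ^+ 2 * (2^-1 * (qform Q (y j) + qform Rw (v j)))
    + dotc (lam j.+1) (coef_variation (x j) (u j) (h *: y j) (h *: v j))
    + h * (dotc (lam j) (y j) - dotc (lam j.+1) (y j.+1)).
  rewrite /seq_lagrangian qform_increment// -lamN.
  have := congr1 ( *%R h) byparts; have := eq_big_nat 0 +%R stage.
  rewrite !big_split/= -!mulr_sumr !big_split/=; lra.
move=> jl; have /(congr1 (fun s => dotc s (v j))) := statU _ jl.
rewrite dotcDl -dotc_mulmx (dotcC 0) dotc0r => statv.
(* at stage 1 the costate recursion is not available, but y 1 = 0 there *)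
have coy : dotc (lam j) (y j)
    = dotc (Q *m x j) (y j) + dotc (lam j.+1) (A (x j) (u j) *m y j).
  have [j2|] := leqP 2 j; first by rewrite dotc_mulmx -dotcDl -lamS//; lia.
  by case: j jl {statv} => [|[|]]// _ _; rewrite y1 mulmx0 !dotc0r addr0.
rewrite !qform_increment// coy /dyn /coef_variation.
rewrite !mulmxBl !mulmxDr -!scalemxAr.
rewrite !(dotcDr, dotcNr, dotcZr).
have -> : dotc (lam j.+1) (B (x j) (u j) *m v j) = - dotc (Rw *m u j) (v j) by lra.
by field.
Qed.

Lemma coef_variation_le L_A L_B x u dx du :
  0 <= L_A ->
  (forall y yh v vh,
     opnorm (A y v - A yh vh) <= L_A * (enorm (y - yh) + enorm (v - vh))) ->
  (forall y yh v vh,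
     opnorm (B y v - B yh vh) <= L_B * (enorm (y - yh) + enorm (v - vh))) ->
  enorm (coef_variation x u dx du)
  <= Num.max L_A L_B * (enorm dx + enorm du)
     * (enorm x + enorm u + (enorm dx + enorm du)).
Proof.
move=> LA0 lipA lipB; set L := Num.max _ _.
have d0 : 0 <= enorm dx + enorm du by rewrite addr_ge0 ?enorm_ge0.
have oA : opnorm (A (x + dx) (u + du) - A x u) <= L * (enorm dx + enorm du).
  have := lipA (x + dx) x (u + du) u; rewrite !(addrAC _ _ (- _)) !subrr !add0r.
  by move=> /le_trans; apply; rewrite ler_wpM2r// le_max lexx.
have oB : opnorm (B (x + dx) (u + du) - B x u) <= L * (enorm dx + enorm du).
  have := lipB (x + dx) x (u + du) u; rewrite !(addrAC _ _ (- _)) !subrr !add0r.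
  by move=> /le_trans; apply; rewrite ler_wpM2r// le_max lexx orbT.
apply: le_trans (enormD _ _) _.
apply: (@le_trans _ _ (L * (enorm dx + enorm du) * enorm (x + dx)
                      + L * (enorm dx + enorm du) * enorm (u + du))).
  by apply: lerD; apply: le_trans (enorm_mulmx _ _) _; rewrite ler_wpM2r ?enorm_ge0.
have LL : 0 <= L * (enorm dx + enorm du) by rewrite mulr_ge0// le_max LA0.
rewrite -mulrDr ler_wpM2l// addrACA.
by apply: lerD; apply: enormD.
Qed.

End Increment.

(** * Differentiability and directional derivatives *)

Section Differentiability.
Local Open Scope classical_set_scope.
Local Open Scope ring_scope.
Variable R : realType.

Lemma differentiable_big (V W : normedModType R) (I : Type) (r : seq I)
    (F : I -> V -> W) z :
  (forall i, differentiable (F i) z) ->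
  differentiable (fun z' => \sum_(i <- r) F i z') z.
Proof.
move=> dF; elim: r => [|i r IHr].
  by under eq_fun do rewrite big_nil; exact: differentiable_cst.
under eq_fun do rewrite big_cons.
exact: differentiableD.
Qed.

(** Reduces matrix-valued maps to scalar ones, by expansion in the canonical
    basis. *)
Lemma differentiable_mx (V : normedModType R) p q (F : V -> 'M[R]_(p, q)) z :
  (forall i j, differentiable (fun z' => F z' i j) z) -> differentiable F z.
Proof.
move=> dF.
have -> : F = fun z' => \sum_i \sum_j F z' i j *: delta_mx i j.
  by apply/funext => z'; exact: matrix_sum_delta.
by do 2 (apply: differentiable_big => ?); exact: differentiableZl.
Qed.

Lemma differentiable_entry (V : normedModType R) p q (F : V -> 'M[R]_(p, q)) z i j :
  differentiable F z -> differentiable (fun z' => F z' i j) z.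
Proof.
by move=> dF; exact: (differentiable_comp dF (differentiable_coord _ i j)).
Qed.

Lemma differentiable_mulmx (V : normedModType R) p q s
    (F : V -> 'M[R]_(p, q)) (G : V -> 'M[R]_(q, s)) z :
  differentiable F z -> differentiable G z ->
  differentiable (fun z' => F z' *m G z') z.
Proof.
move=> dF dG; apply: differentiable_mx => i j.
under eq_fun do rewrite mxE.
by apply: differentiable_big => k; apply: differentiableM; apply: differentiable_entry.
Qed.

Lemma differentiable_dotc (V : normedModType R) d (F G : V -> 'cV[R]_d) z :
  differentiable F z -> differentiable G z ->
  differentiable (fun z' => dotc (F z') (G z')) z.
Proof.
move=> dF dG; under eq_fun do rewrite dotcE.
by apply: differentiable_big => k; apply: differentiableM; apply: differentiable_entry.
Qed.

Lemma differentiable_qform (V : normedModType R) d (M : 'M[R]_d)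
    (F : V -> 'cV[R]_d) z :
  differentiable F z -> differentiable (fun z' => qform M (F z')) z.
Proof.
move=> dF; under eq_fun do rewrite qformE.
apply: differentiable_dotc => //; exact: differentiable_mulmx.
Qed.

Lemma differentiable_usubmx p q (z : 'cV[R]_(p + q)) : differentiable usubmx z.
Proof.
apply: differentiable_mx => i j; under eq_fun do rewrite mxE.
exact: differentiable_coord.
Qed.

Lemma differentiable_dsubmx p q (z : 'cV[R]_(p + q)) : differentiable dsubmx z.
Proof.
apply: differentiable_mx => i j; under eq_fun do rewrite mxE.
exact: differentiable_coord.
Qed.

Lemma differentiable_blk (V : normedModType R) p d
    (F : V -> 'cV[R]_(\sum_(i < p) d)) j z :
  differentiable F z -> differentiable (fun z' => blk (F z') j) z.
Proof.
move=> dF; rewrite /blk; case: insub => [i|]; last exact: differentiable_cst.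
apply: differentiable_mx => a b; under eq_fun do rewrite mxE.
exact: differentiable_entry.
Qed.

(** Differentiability makes the directional derivative linear in the direction,
    so the partial derivatives determine it. *)
Lemma gradient_dotc d (f : 'cV[R]_d -> R) z w :
  differentiable f z -> dotc w (gradient f z) = 'D_w f z.
Proof.
move=> df; have -> : 'D_w f z = 'd f z w by rewrite deriveE.
rewrite [w in RHS]matrix_sum_delta linear_sum dotcE; apply: eq_bigr => i _.
by rewrite big_ord1 linearZ mxE deriveE.
Qed.

(** Comparing the difference quotient with b + |h| C and letting h tend to 0:
    a bound on increments replaces the computation of the derivative. *)
Lemma derive_le (V : normedModType R) (f : V -> R) (z w : V) (b C : R) :
  differentiable f z ->
  (forall h : R, `|f (h *: w + z) - f z| <= `|h| * (b + `|h| * C)) ->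
  'D_w f z <= b.
Proof.
move=> df fle; have dfw : derivable f z w by exact: diff_derivable.
have cvgC : b + `|h| * C @[h --> (0 : R)^'] --> b + `|0 : R| * C.
  apply: cvgD; first exact: cvg_cst.
  by apply: cvgMr_tmp; apply: cvg_norm; exact: nbhs_dnbhs.
rewrite normr0 mul0r addr0 in cvgC.
apply: (ler_cvg_to dfw cvgC); near=> h.
have hn0 : h != 0 by near: h; exact: nbhs_dnbhs_neq.
apply: le_trans (ler_norm _) _.
rewrite normrM normfV ler_pdivrMl ?normr_gt0//; exact: fle.
Unshelve. all: by end_near. Qed.

End Differentiability.

(** * The Lagrangian in stacked variables *)

Section StackedLagrangian.
Variables (R : realType) (n m : nat).
Variables (A : 'cV[R]_n -> 'cV[R]_m -> 'M[R]_n).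
Variables (B : 'cV[R]_n -> 'cV[R]_m -> 'M[R]_(n, m)).
Variables (Q : 'M[R]_n) (Rw : 'M[R]_m) (P : 'M[R]_n).

Lemma lagrangianE ell xi X U Lam :
  lagrangian (ell := ell) A B Q Rw P xi X U Lam
  = seq_lagrangian A B Q Rw P ell (pred_state xi X) (blk U)
      (fun j => blk Lam j.-1).
Proof. by []. Qed.

Lemma pred_stateD p xi (X Y : 'cV[R]_(\sum_(i < p) n)) h j :
  pred_state xi (h *: Y + X) j = pred_state xi X j + h *: pred_state 0 Y j.
Proof.
by rewrite /pred_state; case: ifP; rewrite ?scaler0 ?addr0// blkD blkZ addrC.
Qed.

Lemma differentiable_seq_lagrangian (V : normedModType R) ell lam
    (x : V -> nat -> 'cV[R]_n) (u : V -> nat -> 'cV[R]_m) z :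
  (forall p, differentiable (fun p : 'cV[R]_n * 'cV[R]_m => A p.1 p.2) p) ->
  (forall p, differentiable (fun p : 'cV[R]_n * 'cV[R]_m => B p.1 p.2) p) ->
  (forall j, differentiable (x^~ j) z) -> (forall j, differentiable (u^~ j) z) ->
  differentiable (fun z' => seq_lagrangian A B Q Rw P ell (x z') (u z') lam) z.
Proof.
move=> dA dB dx du.
have dp j := differentiable_pair (dx j) (du j).
apply: differentiableD; first apply: differentiableD.
- by apply: differentiableM; [exact: differentiable_cst | exact: differentiable_qform].
- apply: differentiableM; first exact: differentiable_cst.
  by apply: differentiable_big => j; apply: differentiableD; apply: differentiable_qform.
apply: differentiable_big => j.
apply: differentiable_dotc; first exact: differentiable_cst.
apply: differentiableB => //; apply: differentiableD.
  apply: differentiable_mulmx => //.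
  exact: (differentiable_comp (dp j) (dA _)).
apply: differentiable_mulmx => //.
exact: (differentiable_comp (dp j) (dB _)).
Qed.

Lemma differentiable_lagrangian ell xi Lam z :
  (forall p, differentiable (fun p : 'cV[R]_n * 'cV[R]_m => A p.1 p.2) p) ->
  (forall p, differentiable (fun p : 'cV[R]_n * 'cV[R]_m => B p.1 p.2) p) ->
  differentiable (fun z : 'cV[R]_(\sum_(i < ell.-1) n + \sum_(i < ell.-1) m) =>
    lagrangian A B Q Rw P xi (usubmx z) (dsubmx z) Lam) z.
Proof.
move=> dA dB; apply: differentiable_seq_lagrangian => // j.
  rewrite /pred_state; case: (j <= 1)%N; first exact: differentiable_cst.
  by apply: differentiable_blk; exact: differentiable_usubmx.
by apply: differentiable_blk; exact: differentiable_dsubmx.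
Qed.

(** The two blocks are disjoint parts of w, so their squared norms a^2 and b^2
    add up to at most |w|^2, and a + b <= sqrt 2 sqrt (a^2 + b^2). This is
    where the factor sqrt 2 of the estimate comes from. *)
Lemma stage_norm_le p q (w : 'cV[R]_(\sum_(i < p) n + \sum_(i < q) m)) j :
  enorm (pred_state 0 (usubmx w) j) + enorm (blk (dsubmx w) j)
  <= Num.sqrt 2 * enorm w.
Proof.
set a := enorm _; set b := enorm _.
have a0 : 0 <= a by exact: enorm_ge0.
have b0 : 0 <= b by exact: enorm_ge0.
rewrite -(@ler_pXn2r _ 2)// ?nnegrE ?addr_ge0 ?mulr_ge0 ?enorm_ge0 ?sqrtr_ge0//.
rewrite exprMn sqr_sqrtr// sqr_enorm -[w]vsubmxK dotc_col_mx.
have ax : a ^+ 2 <= dotc (usubmx w) (usubmx w).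
  rewrite sqr_enorm /pred_state; case: ifP => _; last exact: dotc_blk_le.
  by rewrite dotc0r dotc_ge0.
have bu : b ^+ 2 <= dotc (dsubmx w) (dsubmx w) by rewrite sqr_enorm dotc_blk_le.
have := sqr_ge0 (a - b); nra.
Qed.

End StackedLagrangian.

(** * The bound on the gradient *)

Theorem proposition5 (R : realType) (n m ell : nat)
  (A : 'cV[R]_n -> 'cV[R]_m -> 'M[R]_n)
  (B : 'cV[R]_n -> 'cV[R]_m -> 'M[R]_(n, m))
  (Q : 'M[R]_n) (Rw : 'M[R]_m) (P : 'M[R]_n)
  (L_A L_B abar bbar deltaU : R)
  (x : nat -> 'cV[R]_n) (u : nat -> 'cV[R]_m)
  (N : nat -> nat) (Us : nat -> nat -> 'cV[R]_(\sum_(i < ell.-1) m))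
  (k : nat) (Ustar : 'cV[R]_(\sum_(i < ell.-1) m)) (lam : nat -> 'cV[R]_n) :
  (2 <= ell)%N ->
  sym_psd Q -> sym_pd Rw -> sym_pd P ->
  stabilizing_dare_solution (A 0 0) (B 0 0) Q Rw P ->
  iscd_mpc A B Q Rw P x u N Us ->
  continuously_differentiable
    (fun p : 'cV[R]_n * 'cV[R]_m => A p.1 p.2) ->
  continuously_differentiable
    (fun p : 'cV[R]_n * 'cV[R]_m => B p.1 p.2) ->
  0 < L_A -> 0 < L_B ->
  (forall y yh v vh,
     opnorm (A y v - A yh vh) <= L_A * (enorm (y - yh) + enorm (v - vh))) ->
  (forall y yh v vh,
     opnorm (B y v - B yh vh) <= L_B * (enorm (y - yh) + enorm (v - vh))) ->
  0 < abar -> 0 < bbar ->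
  (forall y v, opnorm (A y v) <= abar) ->
  (forall y v, opnorm (B y v) <= bbar) ->
  0 < deltaU ->
  let x1 := dyn A B (x k) (u k) in
  (exists gamma c0 cM : R,
     [/\ 0 < gamma < 1, 1 <= c0, 0 < cM &
         enorm x1 <= Num.min (deltaU / c0) (gamma / cM)]) ->
  unique (fun U => enorm U <= deltaU /\ calM A B Q Rw P x1 U = U) Ustar ->
  let xs := rollout A B x1 Ustar in
  let us := blk Ustar in
  lam ell = P *m xs ell ->
  (forall j, (2 <= j < ell)%N ->
     lam j = Q *m xs j + (A (xs j) (us j))^T *m lam j.+1) ->
  enorm (grad_XU_lagrangian A B Q Rw P x1
           (\mxcol_(i < ell.-1) xs i.+2) Ustar (\mxcol_(i < ell.-1) lam i.+2))
  <= Num.sqrt 2 * Num.max L_A L_B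
     * \sum_(1 <= j < ell) (enorm (xs j) + enorm (us j)) * enorm (lam j.+1).
Proof.
move=> ell2 hQ hR hP _ _ [dA _] [dB _] LA0 LB0 lipA lipB _ _ _ _ _ x1 _.
move=> [[_ fixU] _] xs us lamN lamS.
set X := \mxcol_(i < ell.-1) xs i.+2; set Lam := \mxcol_(i < ell.-1) lam i.+2.
set z := col_mx X Ustar.
have statU : forall j, (1 <= j < ell)%N ->
    Rw *m us j + (B (xs j) (us j))^T *m lam j.+1 = 0.
  exact: (fixed_point_stationary hQ hR hP fixU lamN lamS).
have df := @differentiable_lagrangian _ _ _ A B Q Rw P ell x1 Lam z dA dB.
rewrite /grad_XU_lagrangian -/z; set L := (fun z => lagrangian _ _ _ _ _ _ _ _ _) in df *.
set g := gradient L z; set Lmax := Num.max L_A L_B.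
have xsE j : (1 <= j <= ell)%N -> pred_state x1 X j = xs j.
  case: j => [|[|j]]//= jl; rewrite /pred_state/= /X.
  by rewrite (blk_mxcol (fun i => xs i.+2))//=; lia.
have lamE j : (2 <= j <= ell)%N -> blk Lam j.-1 = lam j.
  case: j => [|[|j]]//= jl; rewrite /Lam.
  by rewrite (blk_mxcol (fun i => lam i.+2))//=; lia.
(* the gradient itself is the direction of displacement *)
pose y := pred_state 0 (usubmx g); pose v := blk (dsubmx g).
pose dv j := enorm (y j) + enorm (v j).
pose q := 2^-1 * qform P (y ell)
  + 2^-1 * \sum_(1 <= j < ell) (qform Q (y j) + qform Rw (v j)).
pose S := \sum_(1 <= j < ell) (enorm (xs j) + enorm (us j)) * enorm (lam j.+1).
have incr h : L (h *: g + z) - L z = h ^+ 2 * q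
    + \sum_(1 <= j < ell)
        dotc (lam j.+1) (coef_variation A B (xs j) (us j) (h *: y j) (h *: v j)).
  rewrite /L !lagrangianE !linearP/= col_mxKu col_mxKd.
  have -> : pred_state x1 (h *: usubmx g + X) = fun j => pred_state x1 X j + h *: y j.
    by apply/funext => j; rewrite pred_stateD.
  have -> : blk (h *: dsubmx g + Ustar) = fun j => us j + h *: v j.
    by apply/funext => j; rewrite blkD blkZ addrC.
  rewrite (@seq_lagrangian_increment _ _ _ A B Q Rw P) ?hQ.1 ?hR.1 ?hP.1//; last 4 first.
  - exact: ltnW.
  - by rewrite xsE ?lamE ?lamN//; lia.
  - move=> j jl; rewrite xsE ?lamE -?lamS//; lia.
  - by move=> j jl; rewrite xsE ?lamE ?statU//; lia.
  congr (_ + _); apply: eq_big_nat => j jl; rewrite xsE ?lamE//; lia.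
have Lmax0 : 0 <= Lmax by rewrite le_max ltW.
have : 'D_g L z <= Lmax * (Num.sqrt 2 * enorm g) * S.
  apply: (@derive_le _ _ _ _ _ _
    (`|q| + Lmax * \sum_(1 <= j < ell) dv j ^+ 2 * enorm (lam j.+1))) => // h.
  rewrite incr; apply: le_trans (ler_normD _ _) _.
  rewrite normrM normrX.
  suff : `|\sum_(1 <= j < ell) dotc (lam j.+1)
             (coef_variation A B (xs j) (us j) (h *: y j) (h *: v j))|
      <= `|h| * (Lmax * (Num.sqrt 2 * enorm g)) * S
         + `|h| ^+ 2 * Lmax * \sum_(1 <= j < ell) dv j ^+ 2 * enorm (lam j.+1) by lra.
  apply: le_trans (ler_norm_sum _ _ _) _.
  rewrite /S !mulr_sumr -big_split/= !big_nat; apply: ler_sum => j jl.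
  apply: le_trans (dotc_le _ _) _.
  have /(ler_wpM2l (enorm_ge0 (lam j.+1)))/le_trans := coef_variation_le
    (xs j) (us j) (h *: y j) (h *: v j) (ltW LA0) lipA lipB.
  apply; rewrite -/Lmax !enormZ -mulrDr -/(dv j).
  set s := enorm (xs j) + enorm (us j); set l := enorm (lam j.+1).
  have dvle : dv j <= Num.sqrt 2 * enorm g by exact: stage_norm_le.
  have weight0 : 0 <= `|h| * Lmax * (s * l).
    by rewrite !mulr_ge0 ?addr_ge0 ?enorm_ge0.
  (* the term of first order in h carries dv j, to be replaced by its bound;
     the term of second order is kept exactly *)
  have := ler_wpM2l weight0 dvle; lra.
rewrite -gradient_dotc// -/g -sqr_enorm => gle.
have S0 : 0 <= S.
  by apply: sumr_ge0 => j _; rewrite mulr_ge0 ?addr_ge0 ?enorm_ge0.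
(* |g|^2 <= |g| c gives |g| <= c after division by |g| when g is nonzero *)
have [->|gn0] := eqVneq (enorm g) 0.
  by rewrite !mulr_ge0 ?sqrtr_ge0.
have gpos : 0 < enorm g by rewrite lt_def gn0 enorm_ge0.
by rewrite -(ler_pM2l gpos) -expr2 -/Lmax -/S; lra.
Qed.
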